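(* Let $d\ge 1$ and let $X$ be a finite set in the unit sphere $S^{m-1}\subset\mathbb{R}^m$ with $|A(X)|\le d$. Let $\theta_1^*>\cdots>\theta_s^*$ (with $s\le d$) be the elements of $A(X)$, and put $\theta_0^*=1$. For $i\in\{1,\ldots,s\}$ let $A_i$ be the adjacency matrix of the graph $G_i=(X,R_i)$ with $R_i=\{(x,y)\mid x,y\in X,\ \langle x,y\rangle=\theta_i^*\}$, and let \[ K_i^*=\prod_{j=1,2,\ldots,s,\ j\neq i}\frac{\theta_0^*-\theta_j^*}{\theta_i^*-\theta_j^*}. \] Assume that $|X|>N(m,d-1)$. Then the following hold. (1) The Schur-diameter of the Gram matrix $M=(\langle x,y\rangle)_{x,y\in X}$ of $X$ is equal to $d$. (2) $|A(X)|=d$ (that is, $s=d$). (3) $-K_i^*$ is an eigenvalue of $A_i$ for each $i\in\{1,2,\ldots,d\}$. (4) For each $i\in\{1,2,\ldots,d\}$, the multiplicity of $-K_i^*$ as an eigenvalue of $A_i$ is at least $|X|-N(m,d-1)$.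
   Context: $\langle x,y\rangle$ is the usual inner product on $\mathbb{R}^m$, and $A(X)=\{\langle x,y\rangle\mid x,y\in X,\ x\neq y\}$. For an integer $e\ge 0$, \[ N(m,e)=\binom{m+e-1}{e}+\binom{m+e-2}{e-1}, \] where a binomial coefficient with negative lower index is $0$ (so $N(m,0)=1$). An empty product is $1$. For a polynomial $q$ and an $n\times n$ matrix $E$, $q(E^{\circ})$ denotes the matrix obtained by evaluating $q$ at $E$ with the Hadamard (entrywise) product as multiplication, i.e. the matrix obtained by applying $q$ to each entry of $E$. The matrix $E$ is Schur-connected if there is a polynomial $q$ such that $q(E^{\circ})$ has rank $n$; the Schur-diameter of a Schur-connected matrix $E$ is the least integer $d$ such that $q(E^\circ)$ has rank $n$ for some polynomial $q$ of degree $d$. The Gram matrix of a finite set in $S^{m-1}$ is always Schur-connected. *)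

(* Defs.v *)
From HB Require Import structures.
From mathcomp Require Import all_boot all_order all_algebra.
From mathcomp Require Import finmap reals.

Set Implicit Arguments.
Unset Strict Implicit.
Unset Printing Implicit Defensive.

Import Order.TTheory GRing.Theory Num.Theory.
Local Open Scope ring_scope.
Local Open Scope fset_scope.

(* The truncated predecessors differ from the integers m + e - 1 and m + e - 2
   only for m = 0, where the sphere is empty. *)
Definition Nbound (m e : nat) : nat :=
  ('C((m + e).-1, e) + (if e is e'.+1 then 'C((m + e).-2, e') else 0))%N.

Definition inner (R : realType) (m : nat) (x y : 'rV[R]_m) : R :=
  \sum_(k < m) x 0 k * y 0 k.

Definition in_unit_sphere (R : realType) (m : nat) (x : 'rV[R]_m) : Prop :=
  inner x x = 1.

Definition inner_products (R : realType) (m : nat) (X : {fset 'rV[R]_m}) :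
    {fset R} :=
  [fset inner x y | x in X, y in X & x != y].

(* Matrices with rows and columns indexed by X are written as square matrices
   of size #|` X|, the i-th index standing for the i-th point of the canonical
   enumeration of X. *)
Definition point (R : realType) (m : nat) (X : {fset 'rV[R]_m})
    (a : 'I_#|` X|) : 'rV[R]_m :=
  nth 0 X a.

Definition gram_mx (R : realType) (m : nat) (X : {fset 'rV[R]_m}) :
    'M[R]_#|` X| :=
  \matrix_(a, b) inner (point a) (point b).

Definition adjacency_mx (R : realType) (m : nat) (X : {fset 'rV[R]_m})
    (r : rel 'rV[R]_m) : 'M[R]_#|` X| :=
  \matrix_(a, b) (r (point a) (point b))%:R.

Definition inner_rel (R : realType) (m : nat) (t : R) : rel 'rV[R]_m :=
  fun x y => inner x y == t.

Definition hadamard_horner (R : realType) (n : nat) (q : {poly R})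
    (E : 'M[R]_n) : 'M[R]_n :=
  map_mx (horner q) E.

Definition schur_connected (R : realType) (n : nat) (E : 'M[R]_n) : Prop :=
  exists q : {poly R}, \rank (hadamard_horner q E) = n.

Definition schur_reach (R : realType) (n : nat) (E : 'M[R]_n) (d : nat) :
    Prop :=
  exists q : {poly R}, size q = d.+1 /\ \rank (hadamard_horner q E) = n.

Definition is_schur_diameter (R : realType) (n : nat) (E : 'M[R]_n) (d : nat) :
    Prop :=
  [/\ schur_connected E,
      schur_reach E d
    & forall d' : nat, schur_reach E d' -> (d <= d')%N].

Definition Kstar (R : realType) (s : nat) (theta : nat -> R) (i : nat) : R :=
  \prod_(1 <= j < s.+1 | j != i)
    ((theta 0%N - theta j) / (theta i - theta j)).

(* Main.v *)
Require Import Defs.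
From HB Require Import structures.
From mathcomp Require Import all_boot all_order all_algebra.
From mathcomp Require Import finmap reals.

Set Implicit Arguments.
Unset Strict Implicit.
Unset Printing Implicit Defensive.

Import Order.TTheory GRing.Theory Num.Theory.
Local Open Scope ring_scope.
Local Open Scope fset_scope.

(** On the unit sphere <y, y> = 1, so every monomial of degree k is a sum of
    monomials of degree k + 2. Hence the functions y |-> <x, y> ^ k with k <= e
    lie in the span of the monomials of degrees e and e - 1, and there are
    N(m, e) of these; so q(M), taken entrywise, has rank
    at most N(m, e) whenever deg q <= e.
    The polynomial vanishing at all the elements of A(X) sends M to a nonzero
    multiple of the identity, which gives (1) and (2); the Lagrange polynomial
    at theta_i sends M to K_i I + A_i, whose rank is thus at most N(m, d - 1),
    which gives (3) and (4). *)

(** * Spans of monomials on a set of points of the sphere *)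

Section Monomials.
Variables (R : realType) (m n : nat) (p : 'I_n -> 'rV[R]_m.+1).

(** A monomial is given by the list of its variables with repetition, so multiplying by a variable
    is a [cons]. *)
Definition monomial_row (t : seq 'I_m.+1) : 'rV[R]_n :=
  \row_a \prod_(k <- t) p a 0 k.

(** One representative per monomial of degree [e], in the shape counted by [card_sorted_tuples]. *)
Definition sorted_tuples (e : nat) : {set e.-tuple 'I_m.+1} :=
  [set t : e.-tuple 'I_m.+1 | sorted leq [seq val i | i <- t]].

Definition monomial_mx (e : nat) : 'M[R]_(#|sorted_tuples e|, n) :=
  \matrix_(i < #|sorted_tuples e|) monomial_row (enum_val i).

(** There is no degree below 0; the brackets only make the matrix square, so that both branches have
    the same type. *)
Definition monomial_space (e : nat) : 'M[R]_n :=
  if e is e'.+1 then (monomial_mx e + monomial_mx e')%MS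
  else <<monomial_mx 0>>%MS.

Lemma monomial_row_sub (t : seq 'I_m.+1) (e : nat) :
  size t = e -> (monomial_row t <= monomial_mx e)%MS.
Proof.
move=> st; pose r : rel 'I_m.+1 := relpre val leq.
have su : size (sort r t) == e by rewrite size_sort st.
have uP : Tuple su \in sorted_tuples e.
  rewrite inE /= sorted_map; apply: sort_sorted => x y; exact: leq_total.
have -> : monomial_row t = row (enum_rank_in uP (Tuple su)) (monomial_mx e).
  rewrite rowK enum_rankK_in //; apply/rowP=> a; rewrite !mxE /=.
  by apply: perm_big; rewrite perm_sym perm_sort.
exact: row_sub.
Qed.

Lemma mxrank_monomial_space (e : nat) :
  (\rank (monomial_space e) <= Nbound m.+1 e)%N.
Proof.
have rk k : (\rank (monomial_mx k) <= 'C(k + m, k))%N.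
  by rewrite (leq_trans (rank_leq_row _)) // card_sorted_tuples.
case: e => [|e] /=; first by rewrite genmxE /Nbound addn0 (leq_trans (rk 0%N)) ?bin0.
apply: leq_trans (mxrank_adds_leqif _ _) _.
rewrite /Nbound addSn addnS /= -addnS !(addnC m).
exact: leq_add (rk _) (rk _).
Qed.

(** Expanding one factor of the power in coordinates moves a variable [j] into [t]; hence [t] is
    arbitrary in the induction, though only the empty list is used later. *)
Lemma monomial_row_inner_sub (x : 'rV[R]_m.+1) (k : nat) (t : seq 'I_m.+1) :
  ((\row_a (inner x (p a) ^+ k * monomial_row t 0 a))%R
     <= monomial_mx (k + size t))%MS.
Proof.
elim: k t => [|k IHk] t.
  suff -> : \row_a (inner x (p a) ^+ 0 * monomial_row t 0 a) = monomial_row t.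
    exact: monomial_row_sub.
  by apply/rowP=> a; rewrite !mxE mul1r.
have -> : \row_a (inner x (p a) ^+ k.+1 * monomial_row t 0 a) =
    \sum_j x 0 j *: \row_a (inner x (p a) ^+ k * monomial_row (j :: t) 0 a).
  apply/rowP=> a; rewrite summxE !mxE exprSr -mulrA {2}/inner mulr_suml.
  rewrite mulr_sumr.
  by apply: eq_bigr => j _; rewrite !mxE big_cons -mulrA mulrCA.
apply: summx_sub => j _; apply: scalemx_sub.
by rewrite addSnnS; exact: (IHk (j :: t)).
Qed.

Hypothesis p_sphere : forall a, in_unit_sphere (p a).

(** Multiply each monomial by 1, written as the sum of the squared coordinates. *)
Lemma monomial_mx_sub2 (e : nat) : (monomial_mx e <= monomial_mx e.+2)%MS.
Proof.
apply/row_subP=> i; rewrite rowK.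
have -> : monomial_row (enum_val i) =
    \sum_j monomial_row [:: j, j & enum_val i].
  apply/rowP=> a; rewrite summxE -[LHS]mul1r -{1}(p_sphere a) mulr_suml.
  by apply: eq_bigr => j _; rewrite !mxE !big_cons mulrA.
by apply: summx_sub => j _; apply: monomial_row_sub; rewrite /= size_tuple.
Qed.

Lemma monomial_mx_sub_space (k e : nat) :
  (k <= e)%N -> (monomial_mx k <= monomial_space e)%MS.
Proof.
elim: e => [|e IHe]; first by rewrite leqn0 => /eqP->; rewrite genmxE.
rewrite leq_eqVlt ltnS => /predU1P[->|/IHe le_k]; first exact: addsmxSl.
(* It remains to see that the spaces increase with the degree: one block is shared, and the lower
   one is lifted by two degrees. *)
apply: submx_trans le_k _; case: e {IHe} => [|e]; first by rewrite genmxE addsmxSr.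
by rewrite /= addsmx_sub addsmxSr (submx_trans (monomial_mx_sub2 e)) ?addsmxSl.
Qed.

Lemma mxrank_horner_inner (q : {poly R}) (e : nat) : (size q <= e.+1)%N ->
  (\rank (\matrix_(a, b) q.[inner (p a) (p b)]) <= Nbound m.+1 e)%N.
Proof.
move=> sq; apply: leq_trans (mxrank_monomial_space e); apply: mxrankS.
apply/row_subP=> a.
have -> : row a (\matrix_(a, b) q.[inner (p a) (p b)]) = \sum_(k < size q)
    q`_k *: \row_b (inner (p a) (p b) ^+ k * monomial_row [::] 0 b).
  apply/rowP=> b; rewrite summxE !mxE horner_coef.
  by apply: eq_bigr => k _; rewrite !mxE big_nil mulr1.
apply: summx_sub => k _; apply: scalemx_sub.
apply: submx_trans (monomial_row_inner_sub _ _ _) _; rewrite addn0.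
by apply: monomial_mx_sub_space; rewrite -ltnS (leq_trans (ltn_ord k)).
Qed.

End Monomials.

(** The squared distance is 1 - 2 + 1 = 0, and a vanishing sum of real squares has vanishing
    terms. *)
Lemma inner_sphere_eq1 (R : realType) (m : nat) (x y : 'rV[R]_m) :
  in_unit_sphere x -> in_unit_sphere y -> inner x y = 1 -> x = y.
Proof.
move=> xx yy xy; have : \sum_k (x 0 k - y 0 k) ^+ 2 = 0.
  transitivity (inner x x - inner x y *+ 2 + inner y y)%R.
    rewrite /inner -sumrMnl -sumrB -big_split /=.
    by apply: eq_bigr => k _; rewrite sqrrB !expr2.
  by rewrite xx yy xy mulr2n opprD addNKr addNr.
move/eqP; rewrite psumr_eq0 => [/allP h|k _]; last exact: sqr_ge0.
apply/rowP=> k; have := h k (mem_index_enum _).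
by rewrite sqrf_eq0 subr_eq0 => /eqP.
Qed.

(** * The Gram matrix of a finite spherical set *)

Section SphericalCode.
Variables (R : realType) (m : nat) (X : {fset 'rV[R]_m}).
Hypothesis X_sphere : forall x, x \in X -> in_unit_sphere x.

Lemma point_in (a : 'I_#|` X|) : point a \in X.
Proof. exact: mem_nth. Qed.

Lemma point_inj : injective (@point R m X).
Proof.
by move=> a b /eqP; rewrite nth_uniq ?fset_uniq // => /eqP; apply: val_inj.
Qed.

Lemma gram_mx_diag (a : 'I_#|` X|) : gram_mx X a a = 1.
Proof. by rewrite mxE; apply/X_sphere/point_in. Qed.

Lemma gram_mx_offdiag (a b : 'I_#|` X|) :
  a != b -> gram_mx X a b \in inner_products X.
Proof.
move=> ab; rewrite mxE; apply/imfset2P; exists (point a); first exact: point_in.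
by exists (point b) => //; rewrite !inE point_in (inj_eq point_inj).
Qed.

Lemma inner_products_neq1 (t : R) : t \in inner_products X -> t != 1.
Proof.
case/imfset2P=> x xX [y]; rewrite !inE => /andP[yX xy] ->.
apply: contra xy => /eqP xy1.
by rewrite (inner_sphere_eq1 (X_sphere xX) (X_sphere yX) xy1).
Qed.

Lemma mxrank_hadamard_gram (q : {poly R}) (e : nat) : (size q <= e.+1)%N ->
  (\rank (hadamard_horner q (gram_mx X)) <= Nbound m e)%N.
Proof.
move=> sq; case: m X X_sphere => [|m'] Y Y_sphere.
  (* In dimension 0 every inner product is an empty sum, so the sphere is empty. *)
  suff Y0 : #|` Y| = 0%N by rewrite (leq_trans (rank_leq_row _)) // Y0.
  apply/eqP; rewrite cardfs_eq0; apply/eqP/fsetP=> x; rewrite inE.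
  apply/negP=> /Y_sphere/eqP.
  by rewrite /inner big_ord0 eq_sym oner_eq0.
rewrite (_ : hadamard_horner _ _ =
  \matrix_(a, b) q.[inner (point a) (point b)]); last first.
  by apply/matrixP=> a b; rewrite !mxE.
apply: mxrank_horner_inner sq => a; apply: Y_sphere; exact: mem_nth.
Qed.

(** * Annihilator and Lagrange polynomials of the inner products *)

Variables (s : nat) (theta : nat -> R).
Hypothesis theta0 : theta 0%N = 1.
Hypothesis theta_decr : forall i j : nat,
  (1 <= i)%N -> (i < j)%N -> (j <= s)%N -> theta j < theta i.
Hypothesis theta_AX : forall t : R,
  t \in inner_products X <-> exists2 i : nat, (1 <= i <= s)%N & t = theta i.

Lemma theta_inj : {in [pred i | (1 <= i <= s)%N] &, injective theta}.
Proof.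
move=> i j; rewrite !inE => /andP[i1 si] /andP[j1 sj] ij.
case: (ltngtP i j) => // lt; first by have := theta_decr i1 lt sj; rewrite ij ltxx.
by have := theta_decr j1 lt si; rewrite ij ltxx.
Qed.

Lemma theta_in (i : nat) : (1 <= i <= s)%N -> theta i \in inner_products X.
Proof. by move=> i1s; apply/theta_AX; exists i. Qed.

Lemma card_inner_products : #|` inner_products X| = s.
Proof.
rewrite -[RHS](size_iota 1 s) -(size_map theta); apply: perm_size.
apply: uniq_perm; first exact: fset_uniq.
  rewrite map_inj_in_uniq ?iota_uniq // => i j.
  by rewrite !mem_iota !add1n !ltnS; apply: theta_inj.
move=> t; apply/idP/mapP => [/theta_AX[i i1s ->]|[i]].
  by exists i; rewrite // mem_iota add1n ltnS.
by rewrite mem_iota add1n ltnS => /theta_in h ->.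
Qed.

(* At [i = 0] no factor is omitted. *)
Definition omit_poly (i : nat) : {poly R} :=
  \prod_(1 <= j < s.+1 | j != i) ('X - (theta j)%:P).

Lemma horner_omit_poly (i : nat) (x : R) :
  (omit_poly i).[x] = \prod_(1 <= j < s.+1 | j != i) (x - theta j).
Proof. by rewrite horner_prod; apply: eq_bigr => j _; rewrite hornerXsubC. Qed.

(** The boolean, read as 0 or 1, counts the omitted factor: the degree is [s - 1] for [i] in range,
    and [s] for [i = 0]. *)
Lemma size_omit_poly (i : nat) :
  size (omit_poly i) = (s - (1 <= i <= s)).+1.
Proof.
rewrite /omit_poly -big_filter size_prod_XsubC size_filter; congr _.+1.
have := count_predC (pred1 i) (index_iota 1 s.+1).
rewrite size_iota subn1 /= count_uniq_mem ?iota_uniq // mem_index_iota ltnS => cnt.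
by apply: canRL (addKn _) _.
Qed.

Lemma omit_poly_theta (i j : nat) : (1 <= j <= s)%N ->
  ((omit_poly i).[theta j] == 0) = (j != i).
Proof.
move=> j1s; rewrite horner_omit_poly; apply/idP/idP => [|ji]; last first.
  by rewrite (big_rem j) /= ?mem_index_iota // ji subrr mul0r.
apply: contraL => /eqP <-; rewrite big_seq_cond prodf_seq_neq0.
apply/allP=> k _; apply/implyP; rewrite mem_index_iota ltnS => /andP[k1s kj].
rewrite subr_eq0; apply: contra kj => /eqP e.
by apply/eqP/esym/theta_inj.
Qed.

Lemma omit_poly_theta0 (i : nat) : (omit_poly i).[1] != 0.
Proof.
rewrite horner_omit_poly big_seq_cond prodf_seq_neq0.
apply/allP=> k _; apply/implyP; rewrite mem_index_iota ltnS => /andP[k1s _].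
by rewrite subr_eq0 eq_sym inner_products_neq1 ?theta_in.
Qed.

Lemma mxrank_annihilator_gram :
  \rank (hadamard_horner (omit_poly 0) (gram_mx X)) = #|` X|.
Proof.
rewrite (_ : hadamard_horner _ _ = ((omit_poly 0).[1])%:M).
  by rewrite mxrank_unit // unitmxE det_scalar unitfE expf_neq0 ?omit_poly_theta0.
apply/matrixP=> a b; rewrite mxE [RHS]mxE.
have [<-|ab] := eqVneq a b; first by rewrite gram_mx_diag.
have /theta_AX[j j1s ->] := gram_mx_offdiag ab.
apply/eqP; rewrite omit_poly_theta //.
by case: j j1s.
Qed.

(** The scaled polynomial is 1 at [theta i], 0 at the other [theta j], and [Kstar] at 1, the
    diagonal entry. The double sign matches the matrix whose kernel defines [eigenspace]. *)
Lemma lagrange_gram (i : nat) : (1 <= i <= s)%N ->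
  hadamard_horner ((omit_poly i).[theta i]^-1 *: omit_poly i) (gram_mx X) =
  adjacency_mx X (inner_rel (theta i)) - (- Kstar s theta i)%:M.
Proof.
move=> i1s; have adjE a b :
    adjacency_mx X (inner_rel (theta i)) a b = (gram_mx X a b == theta i)%:R.
  by rewrite !mxE.
have KE : Kstar s theta i = (omit_poly i).[theta i]^-1 * (omit_poly i).[1].
  by rewrite /Kstar prodf_div theta0 !horner_omit_poly mulrC.
apply/matrixP=> a b.
rewrite mxE hornerZ [RHS]mxE adjE [X in (_ + X)%R]mxE [X in (_ - X)%R]mxE.
have [<-|ab] := eqVneq a b.
  rewrite gram_mx_diag eq_sym (negPf (inner_products_neq1 (theta_in i1s))).
  by rewrite add0r opprK KE.
rewrite subr0; have /theta_AX[j j1s ->] := gram_mx_offdiag ab.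
have [->|ji] := eqVneq j i.
  by rewrite eqxx mulVf // omit_poly_theta // eqxx.
rewrite (inj_in_eq theta_inj) // (negPf ji).
by have := omit_poly_theta i j1s; rewrite ji => /eqP ->; rewrite mulr0.
Qed.

End SphericalCode.

Theorem theorem3p2 (R : realType) (m d : nat) (X : {fset 'rV[R]_m})
    (s : nat) (theta : nat -> R)
    (d_ge1 : (1 <= d)%N)
    (X_sphere : forall x, x \in X -> in_unit_sphere x)
    (AX_le_d : (#|` inner_products X| <= d)%N)
    (theta0 : theta 0%N = 1)
    (theta_decr : forall i j : nat,
       (1 <= i)%N -> (i < j)%N -> (j <= s)%N -> theta j < theta i)
    (theta_AX : forall t : R,
       t \in inner_products X <-> exists2 i : nat, (1 <= i <= s)%N & t = theta i)
    (X_large : (Nbound m d.-1 < #|` X|)%N) :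
  [/\ is_schur_diameter (gram_mx X) d,
      #|` inner_products X| = d /\ s = d,
      forall i : nat, (1 <= i <= d)%N ->
        eigenvalue (adjacency_mx X (inner_rel (theta i))) (- Kstar s theta i)
    & forall i : nat, (1 <= i <= d)%N ->
        (#|` X| - Nbound m d.-1 <=
         \rank (eigenspace (adjacency_mx X (inner_rel (theta i)))
                           (- Kstar s theta i)))%N].
Proof.
have cardA := card_inner_products theta_decr theta_AX.
have rank_lt (q : {poly R}) : (size q <= d)%N ->
    (\rank (hadamard_horner q (gram_mx X)) <= Nbound m d.-1)%N.
  by move=> sq; apply: mxrank_hadamard_gram => //; rewrite prednK.
(* Full rank forces degree at least [d]; this gives both the minimality in (1) and [d <= s]. *)
have full_size (q : {poly R}) :
    \rank (hadamard_horner q (gram_mx X)) = #|` X| -> (d < size q)%N.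
  move=> rkq; rewrite ltnNge; apply/negP=> /rank_lt.
  by rewrite rkq leqNgt X_large.
have rk0 := mxrank_annihilator_gram X_sphere theta_decr theta_AX.
have sd : s = d.
  apply/eqP; rewrite eqn_leq -{1}cardA AX_le_d /= -ltnS.
  by have := full_size _ rk0; rewrite size_omit_poly subn0.
have mult i : (1 <= i <= d)%N -> (#|` X| - Nbound m d.-1 <=
    \rank (eigenspace (adjacency_mx X (inner_rel (theta i)))
                      (- Kstar s theta i)))%N.
  (* By rank-nullity it suffices to bound the rank of the shifted adjacency matrix, the image of a
     polynomial of degree at most [d - 1]. *)
  rewrite -{1}sd => i1s; rewrite /eigenspace mxrank_ker leq_sub2l //.
  rewrite -(lagrange_gram X_sphere theta0 theta_decr theta_AX i1s).
  apply: rank_lt; apply: leq_trans (size_scale_leq _ _) _.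
  by rewrite size_omit_poly i1s subn1 sd prednK.
split=> //.
- split.
  + by exists (omit_poly s theta 0).
  + by exists (omit_poly s theta 0); split; rewrite // size_omit_poly subn0 sd.
  + by move=> d' [q [sq /full_size]]; rewrite sq ltnS.
- by split; rewrite ?cardA.
(* The lower bound on the multiplicity is positive by [X_large]. *)
- move=> i /mult; rewrite /eigenvalue -mxrank_eq0 -lt0n; apply: leq_trans.
  by rewrite subn_gt0.
Qed.
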